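(* Let $\mathcal{B}$ be a basis in $\mathbb{R}^n$, let $(u,\sigma)$ be a pair of weights on $\mathbb{R}^n$, and let $0<p<\infty$. Suppose that $M^{\mathcal{B}}_{-1,\sigma}$ is bounded on $L^p(\sigma)$, i.e. there is a constant $C_0$ such that $$\int_{\mathbb{R}^n} (M^{\mathcal{B}}_{-1,\sigma} f)^p\,\sigma\,dx\le C_0\int_{\mathbb{R}^n}|f|^p\,\sigma\,dx\qquad\text{for all } f\in L^p(\sigma).$$ Then the operator $f\mapsto M^{\mathcal{B}}_{-1}(\sigma^{-1}f)$ is bounded from $L^p(\sigma)$ to $L^p(u)$, i.e. there is a constant $C_1$ such that $$\int_{\mathbb{R}^n} \big(M^{\mathcal{B}}_{-1}(f\sigma^{-1})\big)^p\,u\,dx\le C_1\int_{\mathbb{R}^n}|f|^p\,\sigma\,dx\qquad\text{for all } f\in L^p(\sigma),$$ if and only if there exists a constant $C$ such that $$\int_F \big(M^{\mathcal{B}}_{-1}(\sigma^{-1}\mathbf{1}_F)\big)^p\,u\,dx\le C\,\sigma(F)$$ for every set $F$ that is a finite union of sets in $\mathcal{B}$.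
   Context: A basis $\mathcal{B}$ is a collection of bounded open sets in $\mathbb{R}^n$. A weight is a non-negative locally integrable function on $\mathbb{R}^n$; for a weight $w$ and measurable $E$, $w(E)=\int_E w\,dx$, and $L^p(w)$ is the space of measurable $f$ with $\int_{\mathbb{R}^n}|f|^p w\,dx<\infty$. $\mathbf{1}_F$ denotes the characteristic function of $F$. The harmonic maximal operator with respect to $\mathcal{B}$ is $$M^{\mathcal{B}}_{-1}f(x)=\sup_{B\in\mathcal{B},\,x\in B}\left(\frac{1}{|B|}\int_B|f|^{-1}\,dx\right)^{-1},$$ and the harmonic maximal operator with respect to $\mathcal{B}$ and a weight $w$ is $$M^{\mathcal{B}}_{-1,w}f(x)=\sup_{B\in\mathcal{B},\,x\in B}\left(\frac{1}{w(B)}\int_B|f|^{-1}\,w\,dx\right)^{-1}.$$ Conventions: $1/0=\infty$ and $1/\infty=0$; products $0\cdot\infty$ are $0$; sets $B$ with $w(B)=0$ are omitted from the supremum defining $M^{\mathcal{B}}_{-1,w}$; and $M^{\mathcal{B}}_{-1}f(x)=0$, $M^{\mathcal{B}}_{-1,w}f(x)=0$ when there is no admissible $B\in\mathcal{B}$ containing $x$. *)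

(* Defs.v *)
From HB Require Import structures.
From mathcomp Require Import all_boot all_order all_algebra.
From mathcomp Require Import all_classical all_reals all_analysis.
Set Implicit Arguments.
Unset Strict Implicit.
Unset Printing Implicit Defensive.
Import Order.TTheory GRing.Theory Num.Theory.
Import numFieldNormedType.Exports.
Local Open Scope classical_set_scope.
Local Open Scope ring_scope.

(* R^n is 'rV[R]_n: its library topology and (sup) norm give the usual open,
   bounded and compact sets. *)

(* The product sigma-algebra on 'rV[R]_n: the one generated by the coordinate
   functions, i.e. the Borel sets. *)
Section borel_row_vectors.
Variables (R : realType) (n : nat).

Definition row_coord (i : 'I_n) (x : 'rV[R]_n) : measurableTypeR R := x ord0 i.

Definition row_measurable : set (set 'rV[R]_n) := g_sigma_preimage row_coord.

Let row_measurable0 : row_measurable set0.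
Proof. exact: sigma_algebra0. Qed.

Let row_measurableC A : row_measurable A -> row_measurable (~` A).
Proof. exact: sigma_algebraC. Qed.

Let row_measurable_bigcup (F : (set 'rV[R]_n)^nat) :
  (forall i, row_measurable (F i)) -> row_measurable (\bigcup_i F i).
Proof. exact: sigma_algebra_bigcup. Qed.

Definition row_display : measure_display.
Proof. exact: default_measure_display. Qed.

HB.instance Definition _ := @isMeasurable.Build row_display 'rV[R]_n
  row_measurable row_measurable0 row_measurableC row_measurable_bigcup.

End borel_row_vectors.

Section lebesgue_borel.
Variable R : realType.

Lemma measurable_row_coord n (i : 'I_n) :
  measurable_fun setT (@row_coord R n i).
Proof.
move=> _ Y mY; rewrite setTI; apply: sub_sigma_algebra => /=.
rewrite -bigcup_seq/=; exists i => /=; first by rewrite mem_index_enum.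
by exists Y => //; rewrite setTI.
Qed.

Lemma measurable_fun_rowP d (T : measurableType d) n (f : T -> 'rV[R]_n) :
  (forall i, measurable_fun setT (fun t => row_coord i (f t))) ->
  measurable_fun setT f.
Proof.
move=> mf _ A mA; rewrite setTI.
suff: @row_measurable R n `<=` [set B | measurable (f @^-1` B)] by apply.
apply: smallest_sub.
  split=> /=.
  - by rewrite preimage_set0.
  - by move=> B mB; rewrite setTD preimage_setC; exact: measurableC.
  - by move=> F mF; rewrite preimage_bigcup; exact: bigcupT_measurable.
rewrite -bigcup_seq/=; apply: bigcup_sub => i _ _ [B mB <-] /=.
by rewrite setTI -[X in measurable X]setTI; exact: mf.
Qed.

Definition row_cons n (p : measurableTypeR R * 'rV[R]_n) : 'rV[R]_n.+1 :=
  \row_i (if unlift ord0 i is Some j then p.2 ord0 j else p.1).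

Definition row_uncons n (x : 'rV[R]_n.+1) : measurableTypeR R * 'rV[R]_n :=
  (x ord0 ord0, \row_j x ord0 (lift ord0 j)).

Lemma row_consK n : cancel (@row_cons n) (@row_uncons n).
Proof.
case=> a y; rewrite /row_cons /row_uncons /= mxE unlift_none; congr pair.
by apply/rowP => j; rewrite !mxE liftK.
Qed.

Lemma measurable_row_cons n : measurable_fun setT (@row_cons n).
Proof.
apply: measurable_fun_rowP => i; case: (unliftP ord0 i) => [j ->|->].
- apply: (eq_measurable_fun (row_coord j \o snd)) => [p _ /=|].
    by rewrite /row_coord mxE liftK.
  by apply: measurableT_comp => //; exact: measurable_row_coord.
- apply: (eq_measurable_fun fst) => [p _ /=|//].
  by rewrite /row_coord mxE unlift_none.
Qed.

Lemma measurable_row_uncons n : measurable_fun setT (@row_uncons n).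
Proof.
apply/measurable_fun_pairP; split; first exact: (@measurable_row_coord _ ord0).
apply: measurable_fun_rowP => j.
apply: (eq_measurable_fun (row_coord (lift ord0 j))) => [x _|].
  by rewrite /row_coord mxE.
exact: measurable_row_coord.
Qed.

Section step.
Variables (n : nat) (m : {sigma_finite_measure set 'rV[R]_n -> \bar R}).

Definition lebesgue_step : set 'rV[R]_n.+1 -> \bar R :=
  pushforward (@lebesgue_measure R \x m)%E (@row_cons n).

HB.instance Definition _ := Measure.copy lebesgue_step
  (measure_function_pushforward__canonical__measure_function_Measure
     (@lebesgue_measure R \x m)%E (@measurable_row_cons n)).

Let lebesgue_step_sigma_finite : sigma_finite setT lebesgue_step.
Proof.
have /sigma_finiteP[F [TF ndF Foo]] := sigma_finiteT (@lebesgue_measure R).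
have /sigma_finiteP[G [TG ndG Goo]] := sigma_finiteT m.
exists (fun k => @row_uncons n @^-1` (F k `*` G k)).
  rewrite -preimage_bigcup; apply/esym/seteqP; split=> // x _ /=.
  have [i _ Fi] : (\bigcup_k F k) (row_uncons x).1 by rewrite -TF.
  have [j _ Gj] : (\bigcup_k G k) (row_uncons x).2 by rewrite -TG.
  exists (maxn i j) => //; split.
  - by move: Fi; exact/subsetPset/ndF/leq_maxl.
  - by move: Gj; exact/subsetPset/ndG/leq_maxr.
move=> k; have [mF Fk] := Foo k; have [mG Gk] := Goo k; split.
  rewrite -[X in measurable X]setTI; apply: measurable_row_uncons => //.
  exact: measurableX.
rewrite /lebesgue_step /pushforward -comp_preimage.
rewrite (_ : @row_uncons n \o @row_cons n = id); last first.
  by apply/funext => p; exact: row_consK.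
rewrite preimage_id.
by rewrite product_measure1E// lte_mul_pinfty// ge0_fin_numE.
Qed.

HB.instance Definition _ := Measure_isSigmaFinite.Build _ _ _
  lebesgue_step lebesgue_step_sigma_finite.

End step.

(* Lebesgue measure on the Borel sets of R^n: the n-fold product of the
   one-dimensional one, R^0 being a point of mass 1. *)
Fixpoint borel_lebesgue n : {sigma_finite_measure set 'rV[R]_n -> \bar R} :=
  match n with
  | 0 => \d_(0 : 'rV[R]_0)
  | k.+1 => lebesgue_step (borel_lebesgue k)
  end.

End lebesgue_borel.

(* Same points as 'rV[R]_n, carrying the sigma-algebra of Lebesgue measurable
   sets (Caratheodory extension, i.e. completion, of [borel_lebesgue]). *)
Definition lebesgue_space (R : realType) (n : nat) :=
  caratheodory_type (borel_lebesgue R n)^*%mu.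

HB.instance Definition _ R n := Measurable.on (lebesgue_space R n).

Definition lebesgue (R : realType) (n : nat) :
    {measure set (lebesgue_space R n) -> \bar R} :=
  @completed_measure_extension _ _ _ (borel_lebesgue R n).

Section harmonic_maximal_operator.
Context {R : realType} {n : nat}.
Implicit Types (B : set (set 'rV[R]_n)) (w f : 'rV[R]_n -> R).
Implicit Types (g : 'rV[R]_n -> \bar R) (E : set 'rV[R]_n) (p : R).
Local Open Scope ereal_scope.
Local Notation mu := (lebesgue R n).

Definition lebesgue_measurable f :=
  measurable_fun [set: lebesgue_space R n] (f : lebesgue_space R n -> R).

Definition open_basis B := forall E, B E -> open E /\ bounded_set E.

Definition weight w := [/\ forall x, (0 <= w x)%R, lebesgue_measurable w &
  forall K : set 'rV[R]_n, compact K -> \int[mu]_(x in K) (w x)%:E < +oo].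

Definition wmeas w E : \bar R := \int[mu]_(x in E) (w x)%:E.

(* The p-th power of the (quasi-)norm of L^p(w). *)
Definition Lp_pow p w g : \bar R := \int[mu]_x (`|g x| `^ p * (w x)%:E).

Definition in_Lp p w f :=
  lebesgue_measurable f /\ Lp_pow p w (EFin \o f) < +oo.

(* The inverse of \bar R satisfies 0^-1 = +oo and +oo^-1 = 0, its product
   0 * +oo = 0.  Averages being nonnegative, adjoining 0 to the set only makes
   the supremum 0, instead of -oo, when no set of the family applies. *)
Definition harmonic_maximal B g (x : 'rV[R]_n) : \bar R :=
  ereal_sup (0 |` [set ((mu E)^-1 * \int[mu]_(y in E) `|g y|^-1)^-1
                  | E in [set E | B E /\ E x]]).

Definition weighted_harmonic_maximal B w g (x : 'rV[R]_n) : \bar R :=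
  ereal_sup (0 |` [set
    ((wmeas w E)^-1 * \int[mu]_(y in E) (`|g y|^-1 * (w y)%:E))^-1
    | E in [set E | [/\ B E, E x & wmeas w E != 0]]]).

(* [w^-1 f], extended-valued since w may vanish. *)
Definition divw w f (x : 'rV[R]_n) : \bar R := (f x)%:E / (w x)%:E.

Definition finite_union B E := exists G : set (set 'rV[R]_n),
  [/\ G `<=` B, finite_set G & E = \bigcup_(A in G) A].

End harmonic_maximal_operator.

(* Main.v *)
(** Write [a E = |E| / s(E)] and let [h E] be the [s]-weighted harmonic average of
[f] on [E], so that the average of [f / s] on [E] is at most [a E * h E].  By
the Lindelof property the maximal function is an increasing limit of maxima of
[1_E * a E * h E] over finitely many sets of the basis.  For finitely many sets,
a layer-cake decomposition of [h^p] bounds such a maximum, to the power [p], by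
a sum over levels of maxima of [1_E * (a E)^p] over [{E | h E > level}]; testing
on the union of those sets turns each level into its [s]-measure, and summing
back gives the [p]-th power of the maximum of [1_E * h E], which is dominated by
the weighted maximal function.  Sets with [s(E) = 0] do not contribute, since
testing on them forces [u = 0] almost everywhere there. *)
Require Import Defs.
From mathcomp Require Import all_boot all_order all_algebra.
From mathcomp Require Import all_classical all_reals all_analysis.
From mathcomp Require Import measurable_realfun ring.
Import Order.TTheory GRing.Theory Num.Theory.
Import numFieldNormedType.Exports.
Local Open Scope classical_set_scope.
Local Open Scope ring_scope.
Local Open Scope ereal_scope.
Set Implicit Arguments.
Unset Strict Implicit.
Unset Printing Implicit Defensive.

(** * Discrete layer cake *)

Section max_indic.
Context (T : Type) (R : realType) (I : eqType) (E : I -> set T).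
Implicit Types (l : seq I) (w a v : I -> R) (c : R).

(** With constant weight 1 this is the indicator of the union of the listed sets; the floor 0 is its
    value off that union. *)
Definition max_indic l w (x : T) : R :=
  \big[Num.max/0%R]_(i <- l) (w i * \1_(E i) x)%R.

Lemma max_indic_ge0 l w x : (0 <= max_indic l w x)%R.
Proof. exact: bigmax_ge_id. Qed.

Lemma max_indic_ub l w i x : i \in l -> (w i * \1_(E i) x <= max_indic l w x)%R.
Proof.
move=> il.
exact: (le_bigmax_seq 0%R i xpredT (fun i => w i * \1_(E i) x)%R il isT).
Qed.

Lemma max_indic_le l w x y : (0 <= y)%R ->
  (forall i, i \in l -> (w i * \1_(E i) x <= y)%R) -> (max_indic l w x <= y)%R.
Proof.
by move=> y0 wy; rewrite /max_indic big_seq; apply: bigmax_le => // i /wy.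
Qed.

Lemma max_indic_scale l w c x : (0 <= c)%R ->
  (c * max_indic l w x)%R = max_indic l (fun i => c * w i)%R x.
Proof.
move=> c0; rewrite /max_indic.
rewrite (big_morph (fun y => c * y)%R (id1 := 0%R) (op1 := Num.max))//.
- by apply: eq_bigr => i _; rewrite mulrA.
- by move=> y z; rewrite maxr_pMr.
- by rewrite mulr0.
Qed.

Lemma max_indic1_le1 l x : (max_indic l (cst 1%R) x <= 1)%R.
Proof.
by apply: max_indic_le => // i _; rewrite mul1r indicE; case: (_ \in _).
Qed.

(** Each weight splits as [a i * (v i0 - c) + a i * (v i - v i0)], and a maximum is subadditive; the
    second summand vanishes at [i0], which thus drops out of the second maximum. *)
Lemma max_indic_layer_le l i0 a v c x : (forall i, 0 <= a i)%R ->
  (c <= v i0)%R ->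
  (max_indic (i0 :: l) (fun i => a i * (v i - c)) x <=
   (v i0 - c) * max_indic (i0 :: l) a x
     + max_indic l (fun i => a i * (v i - v i0)) x)%R.
Proof.
move=> a0 cv; have cv0 : (0 <= v i0 - c)%R by rewrite subr_ge0.
apply: max_indic_le => [|i].
  by rewrite addr_ge0 ?mulr_ge0 ?max_indic_ge0.
move=> il.
have -> : (a i * (v i - c) * \1_(E i) x =
  (v i0 - c) * (a i * \1_(E i) x) + a i * (v i - v i0) * \1_(E i) x)%R.
  by ring.
apply: lerD; first by rewrite ler_wpM2l// max_indic_ub.
move: il; rewrite in_cons => /predU1P[->|il].
  by rewrite subrr mulr0 mul0r max_indic_ge0.
exact: (@max_indic_ub l (fun i => a i * (v i - v i0))%R).
Qed.

(** With [a = 1] the splitting loses nothing: raising the base from [c] to the least value [v i0]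
    lowers the maximum by exactly [v i0 - c] on the union of the sets, and off it everything is
    0. *)
Lemma max_indic_layer_ge l i0 v c x : (c <= v i0)%R ->
  (forall i, i \in l -> (v i0 <= v i)%R) ->
  ((v i0 - c) * max_indic (i0 :: l) (cst 1) x
     + max_indic l (fun i => v i - v i0) x <=
   max_indic (i0 :: l) (fun i => v i - c) x)%R.
Proof.
move=> cv vl; have cv0 : (0 <= v i0 - c)%R by rewrite subr_ge0.
have low : ((v i0 - c) * max_indic (i0 :: l) (cst 1) x <=
            max_indic (i0 :: l) (fun i => v i - c) x)%R.
  rewrite max_indic_scale//; apply: max_indic_le => [|i il].
    exact: max_indic_ge0.
  apply: (le_trans _ (@max_indic_ub (i0 :: l) (fun i => v i - c)%R i x il)).
  rewrite mulr1 ler_wpM2r// ?lerD2r//.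
  by move: il; rewrite in_cons => /predU1P[->//|/vl].
(* [low] makes the difference nonnegative, as a maximum with floor 0 requires, and also settles the
   indices whose set misses [x]. *)
rewrite addrC -lerBrDr; apply: max_indic_le => [|i il]; first by rewrite subr_ge0.
rewrite lerBrDr indicE; case: (boolP (x \in E i)) => xE; last first.
  by rewrite mulr0 add0r.
have := @max_indic_ub (i0 :: l) (fun i => v i - c)%R i x.
rewrite in_cons il orbT => /(_ isT); apply: le_trans.
rewrite indicE xE !mulr1 -[leRHS](subrKA (v i0)) lerD2l -[leRHS]mulr1.
by rewrite ler_wpM2l// max_indic1_le1.
Qed.

End max_indic.

(** * The layer cake under the integral, with two weights *)

Section layer_cake_max.
Context d (T : measurableType d) (R : realType).
Variable mu : {measure set T -> \bar R}.
Variables (I : eqType) (E : I -> set T).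
Hypothesis mE : forall i, measurable (E i).
Local Notation max_indic := (max_indic E).
Implicit Types (l : seq I) (w a v : I -> R) (c : R).

Lemma measurable_max_indic l w : measurable_fun setT (max_indic l w).
Proof.
elim: l => [|i l IH].
  by rewrite [max_indic _ _](_ : _ = cst 0%R)//; apply/funext => x;
    rewrite /max_indic big_nil.
rewrite [max_indic _ _](_ : _ = fun x => Num.max (w i * \1_(E i) x)%R (max_indic l w x));
  last by apply/funext => x; rewrite /max_indic big_cons.
apply: measurable_maxr => //; apply: measurable_funM => //.
Qed.

Variables (u s : T -> R) (C : R).
Hypotheses (u0 : forall x, (0 <= u x)%R) (mu_ : measurable_fun setT u).
Hypotheses (s0 : forall x, (0 <= s x)%R) (ms : measurable_fun setT s).
Hypothesis C0 : (0 <= C)%R.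

Let mMu l w : measurable_fun setT (fun x => (max_indic l w x)%:E * (u x)%:E).
Proof.
apply: emeasurable_funM; apply/measurable_EFinP => //.
exact: measurable_max_indic.
Qed.

Let mMs l w : measurable_fun setT (fun x => (max_indic l w x)%:E * (s x)%:E).
Proof.
apply: emeasurable_funM; apply/measurable_EFinP => //.
exact: measurable_max_indic.
Qed.

(* At each step the head [i0] of the list carries the least value; peeling
   off the slab between [c] and [v i0] leaves the sum of two terms, the first
   of which is an instance of the testing hypothesis. *)
Lemma testing_sorted l a v c : (forall i, 0 <= a i)%R ->
  (forall l', {subset l' <= l} ->
    \int[mu]_x ((max_indic l' a x)%:E * (u x)%:E) <=
    C%:E * \int[mu]_x ((max_indic l' (cst 1%R) x)%:E * (s x)%:E)) ->
  sorted (fun i j => v i <= v j)%R l ->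
  (forall i, i \in l -> (c <= v i)%R) ->
  \int[mu]_x ((max_indic l (fun i => a i * (v i - c))%R x)%:E * (u x)%:E) <=
  C%:E * \int[mu]_x ((max_indic l (fun i => v i - c)%R x)%:E * (s x)%:E).
Proof.
(* The base level [c] is generalised because the tail is treated at base level [v i0]. *)
move=> a0; elim: l c => [|i0 l IH] c test vsort cv.
  rewrite integral0_eq.
    by rewrite mule_ge0 ?lee_fin// integral_ge0// => x _;
      rewrite mule_ge0 ?lee_fin ?max_indic_ge0.
  by move=> x _; rewrite /max_indic big_nil mul0e.
have ci0 : (c <= v i0)%R by apply: cv; rewrite mem_head.
have cv0 : (0 <= v i0 - c)%R by rewrite subr_ge0.
have vl i : i \in l -> (v i0 <= v i)%R.
  have tr : transitive (fun i j => v i <= v j)%R by move=> ? ? ?; exact: le_trans.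
  by move: vsort => /= /(order_path_min tr) /allP /[apply].
have {}IH : \int[mu]_x ((max_indic l (fun i => a i * (v i - v i0))%R x)%:E * (u x)%:E) <=
  C%:E * \int[mu]_x ((max_indic l (fun i => v i - v i0)%R x)%:E * (s x)%:E).
  apply: IH => //; last by move: vsort => /= /path_sorted.
  by move=> l' l'l; apply: test => i /l'l il; rewrite in_cons il orbT.
have m0 l' w x : 0 <= (max_indic l' w x)%:E by rewrite lee_fin max_indic_ge0.
have mu0 l' w x : 0 <= (max_indic l' w x)%:E * (u x)%:E.
  by rewrite mule_ge0 ?lee_fin ?max_indic_ge0.
have ms0 l' w x : 0 <= (max_indic l' w x)%:E * (s x)%:E.
  by rewrite mule_ge0 ?lee_fin ?max_indic_ge0.
apply: (@le_trans _ _ (\int[mu]_x ((v i0 - c)%:E *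
    ((max_indic (i0 :: l) a x)%:E * (u x)%:E)
    + (max_indic l (fun i => a i * (v i - v i0))%R x)%:E * (u x)%:E))).
  apply: ge0_le_integral => //.
    apply: emeasurable_funD => //; apply: emeasurable_funM => //.
  move=> x _; rewrite muleA -ge0_muleDl ?mule_ge0//.
  by rewrite lee_wpmul2r ?lee_fin// max_indic_layer_le.
apply: (@le_trans _ _ (C%:E * \int[mu]_x ((v i0 - c)%:E *
    ((max_indic (i0 :: l) (cst 1%R) x)%:E * (s x)%:E)
    + (max_indic l (fun i => v i - v i0)%R x)%:E * (s x)%:E))); last first.
  rewrite lee_wpmul2l ?lee_fin//; apply: ge0_le_integral => //.
  - by move=> x _; apply: adde_ge0 => //; exact: mule_ge0.
  - by apply: emeasurable_funD => //; apply: emeasurable_funM.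
  - move=> x _; rewrite muleA -ge0_muleDl ?mule_ge0//.
    by rewrite lee_wpmul2r ?lee_fin// max_indic_layer_ge.
rewrite !ge0_integralD ?ge0_integralZl_EFin//; last first.
- by apply: emeasurable_funM.
- by move=> x _; rewrite mule_ge0.
- by apply: emeasurable_funM.
- by move=> x _; rewrite mule_ge0.
rewrite [leRHS]ge0_muleDr; last 2 first.
- - by apply: mule_ge0 => //; apply: integral_ge0.
- by apply: integral_ge0.
by apply: leeD => //; rewrite muleCA lee_wpmul2l ?lee_fin// test.
Qed.

End layer_cake_max.

(** * Rational boxes and Lebesgue measure *)

Lemma exists_rat_between (R : realType) (x y : \bar R) : x < y ->
  exists q : rat, x < (ratr q)%:E < y.
Proof.
case: x y => [r||] [s||]//=; rewrite ?lte_fin => rs.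
- by have [q /[!in_itv]] := rat_in_itvoo rs; exists q.
- have [|q /[!in_itv]/= /andP[rq _]] := @rat_in_itvoo R r (r + 1)%R.
    by rewrite ltrDl.
  by exists q; rewrite lte_fin rq ltry.
- have [|q /[!in_itv]/= /andP[_ qs]] := @rat_in_itvoo R (s - 1)%R s.
    by rewrite gtrDl oppr_lt0.
  by exists q; rewrite lte_fin qs ltNyr.
- by exists 0%R; rewrite ltNyr ltry.
Qed.

Section rational_boxes.
Variables (R : realType) (n : nat).

(** A countable index type: a rational centre, and a [k] standing for the sup-norm radius
    [1 / (k + 1)]. *)
Definition rat_box (b : 'rV[rat]_n * nat) : set 'rV[R]_n :=
  [set y | forall i, (`|ratr (b.1 ord0 i) - y ord0 i| < b.2.+1%:R^-1)%R].

Lemma rat_box_base (E : set 'rV[R]_n) x : open E -> E x ->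
  exists b, rat_box b x /\ rat_box b `<=` E.
Proof.
move=> oE Ex; have /nbhs_ballP[e /= e0 xeE] : nbhs x E.
  by move: oE; rewrite openE => /(_ x Ex).
have [k k2e] : exists k, (k.+1%:R^-1 < e / 2)%R.
  have := near_infty_natSinv_lt (PosNum (divr_gt0 e0 (ltr0Sn R 1))).
  by case=> N _ /(_ N (leqnn _)); exists N.
have k0 : (0 < k.+1%:R^-1 :> R)%R by rewrite invr_gt0.
have /choice[q qx] (i : 'I_n) : exists q : rat, (`|ratr q - x ord0 i| < k.+1%:R^-1)%R.
  have [|q] := @rat_in_itvoo R (x ord0 i - k.+1%:R^-1)%R (x ord0 i + k.+1%:R^-1)%R.
    by rewrite ltrBlDr -addrA ltrDl addr_gt0.
  by rewrite in_itv/= => qx; exists q; rewrite ltr_distl.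
exists (\row_i q i, k); split=> [i|y yq]; first by rewrite /= mxE; exact: qx.
apply: xeE; split=> // i j; rewrite (ord1 i) /ball/=.
have := yq j; rewrite /= mxE => qy.
rewrite (le_lt_trans (ler_distD (ratr (q j)) _ _))//.
rewrite [ltRHS]splitr ltrD// ?(lt_trans _ k2e)//.
by rewrite distrC; exact: qx.
Qed.

Lemma measurable_rat_box b : measurable (rat_box b).
Proof.
rewrite [rat_box b](_ : _ = \bigcap_(i in [set: 'I_n])
    (row_coord i @^-1` (ball (ratr (b.1 ord0 i) : R) b.2.+1%:R^-1))).
  apply: fin_bigcap_measurable => // i _.
  rewrite -[X in measurable X]setTI.
  by apply: measurable_row_coord => //; exact: measurable_ball.
by apply/seteqP; split=> [y yb i _|y yb i]; [exact: yb|exact: (yb i Logic.I)].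
Qed.

Lemma open_row_measurable (E : set 'rV[R]_n) : open E -> measurable E.
Proof.
move=> oE; rewrite (_ : E = \bigcup_(b in [set b | rat_box b `<=` E]) rat_box b).
  rewrite bigcup_mkcond; apply: countable_bigcupT_measurable => [|b].
    exact: countableP.
  by case: ifP => // _; exact: measurable_rat_box.
apply/seteqP; split=> [x Ex|x [b /= + bx]]; last exact.
by have [b [bx bE]] := rat_box_base oE Ex; exists b.
Qed.

(** For each rational box and rational [q], one set of [P] containing the box and with [c > q] is
    selected, if there is one. A box around [x] inside [E] and a [q] between [t] and [c E] then
    point to a selected set that serves. *)
Lemma lindelof_row (P : set (set 'rV[R]_n)) (c : set 'rV[R]_n -> \bar R) :
  (forall E, P E -> open E) ->
  exists2 G : nat -> set 'rV[R]_n, (forall i, G i = set0 \/ P (G i)) &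
    forall E x t, P E -> E x -> t < c E -> exists i, G i x /\ t < c (G i).
Proof.
move=> oP.
pose Q (b : ('rV[rat]_n * nat) * rat) : set (set 'rV[R]_n) :=
  [set E | [/\ P E, rat_box b.1 `<=` E & (ratr b.2)%:E < c E]].
(* [set0] stands in for codes that decode to nothing or to a pair without candidates. *)
pose G k := if unpickle k is Some b then xget set0 (Q b) else set0.
exists G => [k|E x t PE Ex tcE].
  rewrite /G; case: unpickle => [b|]; last by left.
  by case: xgetP => [E _ [PE _ _]|_]; [right|left].
have [q /andP[tq qcE]] := exists_rat_between tcE.
have [b [bx bE]] := rat_box_base (oP _ PE) Ex.
have := @xgetPex _ set0 (Q (b, q)) (ex_intro _ E (And3 PE bE qcE)).
move=> -[PG bG qG]; exists (pickle (b, q)); rewrite /G pickleK.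
by split; [exact: bG|exact: (lt_trans tq)].
Qed.

End rational_boxes.

(** * Lebesgue measure of open sets and of bounded sets *)

Section lebesgue_regularity.
Variables (R : realType) (n : nat).

Lemma open_lebesgue_measurable (E : set 'rV[R]_n) :
  open E -> measurable (E : set (lebesgue_space R n)).
Proof.
by move=> oE; apply: sub_caratheodory; apply: sub_sigma_algebra;
  exact: open_row_measurable.
Qed.

Definition cube m (r : R) : set 'rV[R]_m :=
  [set v | forall i, v ord0 i \in `[(- r)%R, r]].

Arguments cube : clear implicits.

Lemma measurable_cube m r : measurable (cube m r).
Proof.
rewrite [cube m r](_ : _ = \bigcap_(i in [set: 'I_m])
    (row_coord i @^-1` `[(- r)%R, r]%classic)).
  apply: fin_bigcap_measurable => // i _.
  rewrite -[X in measurable X]setTI.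
  by apply: measurable_row_coord => //; exact: measurable_itv.
by apply/seteqP; split=> [y yb i _|y yb i]; [exact: yb|exact: (yb i Logic.I)].
Qed.

(** Under [row_cons] the cube pulls back to an interval times the cube of one dimension less. *)
Lemma borel_lebesgue_cube m r : borel_lebesgue R m (cube m r) < +oo.
Proof.
elim: m => [|m IH] /=; first by rewrite diracE; case: (_ \in _); rewrite ltry.
rewrite /lebesgue_step /pushforward.
rewrite (_ : _ @^-1` _ = `[(- r)%R, r]%classic `*` cube m r).
  rewrite product_measure1E//; last exact: measurable_cube.
  rewrite lte_mul_pinfty//.
    rewrite ge0_fin_numE//.
    suff : lebesgue_measure (`[(- r)%R, r]%classic : set R) < +oo by [].
    by rewrite lebesgue_measure_itv; case: ifP => _; rewrite ltry.
apply/seteqP; split=> [[a y] /= ary|[a y] /= [ar yr] i].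
  split=> /=; first by have := ary ord0; rewrite /row_cons mxE unlift_none.
  by move=> i; have := ary (lift ord0 i); rewrite /row_cons mxE liftK.
by rewrite /row_cons mxE; case: (unliftP ord0 i) => [j|] _ //=; exact: yr.
Qed.

Lemma bounded_sub_cube (E : set 'rV[R]_n) :
  bounded_set E -> exists r, E `<=` cube n r.
Proof.
move=> [M [Mreal EM]]; exists (M + 1)%R => v Ev i.
have vM : (`|v| <= M + 1)%R by apply: EM => //; rewrite ltrDl.
rewrite in_itv/= -ler_norml; apply: le_trans vM.
rewrite [leRHS]/Num.norm /= mx_normrE.
exact: (le_bigmax _ (fun ij => `|v ij.1 ij.2|%R) (ord0, i)).
Qed.

(** Weights are integrable on compact sets; cubes are the compact sets used to enclose bounded
    ones. *)
Lemma compact_cube r : compact (cube n r).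
Proof.
apply: (@rV_compact _ _ (fun=> `[(- r)%R, r]%classic)) => _.
exact: segment_compact.
Qed.

Lemma bounded_lebesgue_fin (E : set 'rV[R]_n) :
  bounded_set E -> lebesgue R n E < +oo.
Proof.
move=> /bounded_sub_cube[r Er].
apply: (@le_lt_trans _ _ (lebesgue R n (cube n r))).
  (* [lebesgue] is given by an outer measure, hence monotone on arbitrary sets. *)
  exact: le_outer_measure.
rewrite /lebesgue/= /completed_measure_extension measurable_mu_extE.
  exact: borel_lebesgue_cube.
exact: measurable_cube.
Qed.

End lebesgue_regularity.

(** * Suprema over the sets of a family containing a point *)

Section extended_reals.
Variable R : realType.
Implicit Types (x y : \bar R) (p : R).

Lemma ge0_le_poweR p x y : (0 <= p)%R -> 0 <= x -> x <= y -> x `^ p <= y `^ p.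
Proof.
move=> p0 x0 xy; apply: gt0_ler_poweR => //; rewrite in_itv/= leey andbT//.
exact: le_trans xy.
Qed.

Lemma poweRVK p x : (0 < p)%R -> 0 <= x -> (x `^ p) `^ p^-1 = x.
Proof. by move=> p0 x0; rewrite -poweRrM divff ?gt_eqF// poweRe1. Qed.

Lemma poweRKV p x : (0 < p)%R -> 0 <= x -> (x `^ p^-1) `^ p = x.
Proof. by move=> p0 x0; rewrite -poweRrM mulVf ?gt_eqF// poweRe1. Qed.

(** For [g >= 0], [1 / g > r] means [g < 1 / r] when [r >= 0], including [r = 0] with [1 / 0 = +oo],
    and always holds when [r < 0]. *)
Lemma ge0_measurable_inve d (T : measurableType d) (D : set T) (g : T -> \bar R) :
  (forall t, 0 <= g t) -> measurable_fun D g -> measurable_fun D (fun t => (g t)^-1).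
Proof.
move=> g0 mg mD.
apply: (measurability _ (ErealGenOInfty.measurableE R)) => // _ [_ [r ->] <-].
rewrite preimage_itvoy; have [r0|r0] := ltP r 0%R.
  rewrite (_ : _ `&` _ = D)//; apply/seteqP; split=> [x []//|x Dx]; split=> //=.
  by rewrite (lt_le_trans _ (_ : 0 <= (g x)^-1)) ?lte_fin// inve_ge0.
rewrite (_ : _ `&` _ = D `&` [set x | g x < r%:E^-1]).
  exact: emeasurable_fun_infty_o.
by apply/seteqP; split=> x [Dx] /=; rewrite inve_pgt ?inE.
Qed.

End extended_reals.

(** * A common form of both maximal operators and its countable approximation *)

Section supremum_over_neighbourhoods.
Variables (R : realType) (n : nat).
Implicit Types (P : set (set 'rV[R]_n)) (c : set 'rV[R]_n -> \bar R) (x : 'rV[R]_n).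

Definition basis_sup P c x : \bar R :=
  ereal_sup (0 |` [set c E | E in [set E | P E /\ E x]]).

Lemma basis_sup_ge0 P c x : 0 <= basis_sup P c x.
Proof. by apply: ereal_sup_ubound; left. Qed.

Lemma basis_sup_ub P c x E : P E -> E x -> c E <= basis_sup P c x.
Proof. by move=> PE Ex; apply: ereal_sup_ubound; right; exists E. Qed.

Lemma basis_sup_le P c x y : 0 <= y ->
  (forall E, P E -> E x -> c E <= y) -> basis_sup P c x <= y.
Proof.
by move=> y0 cy; apply/ereal_supP => _ [->//|[E [PE Ex] <-]]; exact: cy.
Qed.

(** The power [p] is an increasing bijection of [[0, +oo]]; the harder inequality comes from taking
    [p^-1]-th powers. *)
Lemma poweR_basis_sup P c x p : (0 < p)%R -> (forall E, 0 <= c E) ->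
  basis_sup P c x `^ p = basis_sup P (fun E => c E `^ p) x.
Proof.
move=> p0 c0; apply/eqP; rewrite eq_le; apply/andP; split; last first.
  apply: basis_sup_le => [|E PE Ex]; first exact: poweR_ge0.
  by rewrite ge0_le_poweR ?(ltW p0)//; exact: basis_sup_ub.
rewrite -[leRHS](poweRKV p0 (basis_sup_ge0 _ _ _)).
apply: ge0_le_poweR; rewrite ?(ltW p0) ?basis_sup_ge0//.
apply: basis_sup_le => [|E PE Ex]; first exact: poweR_ge0.
rewrite -[leLHS](poweRVK p0 (c0 E)); apply: ge0_le_poweR => //.
- by rewrite invr_ge0 ltW.
- exact: poweR_ge0.
- exact: (@basis_sup_ub P (fun E => c E `^ p)).
Qed.

(** [c] may be [+oo]; off [G M] the product is still 0, by [+oo * 0 = 0]. *)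
Fixpoint partial_sup (G : nat -> set 'rV[R]_n) c N x : \bar R :=
  if N is M.+1 then maxe (partial_sup G c M x) (c (G M) * (\1_(G M) x)%:E) else 0.

Lemma partial_sup_nd G c x :
  {homo (fun N => partial_sup G c N x) : N M / (N <= M)%N >-> N <= M}.
Proof. by apply/nondecreasing_seqP => N /=; rewrite le_max lexx. Qed.

Lemma partial_sup_ge0 G c N x : 0 <= partial_sup G c N x.
Proof. exact: (@partial_sup_nd G c x 0%N N). Qed.

Lemma partial_sup_le G c N x y : 0 <= y ->
  (forall i, (i < N)%N -> G i x -> c (G i) <= y) -> partial_sup G c N x <= y.
Proof.
move=> y0; elim: N => //= N IH cy; rewrite ge_max IH/=; last first.
  by move=> i iN; apply: cy; exact: ltnW.
rewrite indicE; case: (boolP (x \in (G N : set _))) => [/set_mem Gx|_].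
  by rewrite mule1 cy.
by rewrite mule0.
Qed.

Lemma measurable_partial_sup G c N : (forall i, open (G i)) ->
  measurable_fun [set: lebesgue_space R n] (partial_sup G c N).
Proof.
move=> oG; elim: N => [|N IH].
  exact: measurable_cst.
apply: measurable_maxe; first exact: IH.
apply: emeasurable_funM; first exact: measurable_cst.
by apply/measurable_EFinP/measurable_indic; exact: open_lebesgue_measurable.
Qed.

Lemma basis_sup_lim P c : (forall E, P E -> open E) -> (forall E, 0 <= c E) ->
  exists2 G : nat -> set 'rV[R]_n, (forall i, G i = set0 \/ P (G i)) &
    forall x, partial_sup G c N x @[N --> \oo] --> basis_sup P c x.
Proof.
move=> oP c0; have [G GP Gsup] := lindelof_row c oP; exists G => // x.
rewrite [X in _ --> X](_ : _ = ereal_sup (range (fun N => partial_sup G c N x))).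
  by apply: ereal_nondecreasing_cvgn; exact: partial_sup_nd.
apply/eqP; rewrite eq_le; apply/andP; split.
  apply: basis_sup_le => [|E PE Ex].
    apply: (@le_trans _ _ (partial_sup G c 0 x)); first exact: partial_sup_ge0.
    by apply: ereal_sup_ubound; exists 0%N.
  (* A set beating every partial supremum would, by the choice of [G], yield a [G i] that beats them
     too, yet [G i] is counted at stage [i.+1]. *)
  rewrite leNgt; apply/negP => /(Gsup _ _ _ PE Ex)[i [Gx]].
  apply/negP; rewrite -leNgt.
  apply: (@le_trans _ _ (partial_sup G c i.+1 x)).
    by rewrite /= indicE mem_set// mule1 le_max lexx orbT.
  by apply: ereal_sup_ubound; exists i.+1.
apply/ereal_supP => _ [N _ <-]; apply: partial_sup_le => [|i _ Gx].
  exact: basis_sup_ge0.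
by apply: basis_sup_ub => //; case: (GP i) => // Gi0; move: Gx; rewrite Gi0.
Qed.

Lemma measurable_basis_sup P c : (forall E, P E -> open E) -> (forall E, 0 <= c E) ->
  measurable_fun [set: lebesgue_space R n] (basis_sup P c).
Proof.
move=> oP c0; have [G GP Gc] := basis_sup_lim oP c0.
apply: (@emeasurable_fun_cvg _ (lebesgue_space R n) R setT
  (partial_sup G c) (basis_sup P c)) => [N|x _]; last exact: Gc.
by apply: measurable_partial_sup => i; case: (GP i) => [->|/oP//]; exact: open0.
Qed.

End supremum_over_neighbourhoods.

(** * Weighted integrals *)

Section weighted_integrals.
Context d (T : measurableType d) (R : realType).
Variable mu : {measure set T -> \bar R}.
Implicit Types (E : set T) (f u : T -> R).

Lemma integral0_ae_eq0 E f : measurable E -> (forall x, 0 <= f x)%R ->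
  measurable_fun setT f -> \int[mu]_(x in E) (f x)%:E = 0 ->
  {ae mu, forall x, E x -> f x = 0%R}.
Proof.
move=> mE f0 mf f_eq0.
have : ae_eq mu E (EFin \o f) (cst 0).
  apply/(ae_eq_integral_abs mu mE).
    exact/measurable_funTS/measurable_EFinP.
  by rewrite -[RHS]f_eq0; apply: eq_integral => x _; rewrite gee0_abs// lee_fin.
by apply: filterS => x + Ex => /(_ Ex)[].
Qed.

Lemma ae_imply (P Q : T -> Prop) : (forall x, P x -> Q x) ->
  {ae mu, forall x, P x} -> {ae mu, forall x, Q x}.
Proof. by move=> PQ; apply: filterS. Qed.

(** Monotone convergence: a bound for a supremum reduces to a uniform bound for its finite
    stages. *)
Lemma integral_lim_le (F : nat -> T -> \bar R) (g : T -> \bar R) u (K : \bar R) :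
  (forall N, measurable_fun setT (F N)) -> (forall N x, 0 <= F N x) ->
  (forall x, {homo (fun N => F N x) : N M / (N <= M)%N >-> N <= M}) ->
  (forall x, F N x @[N --> \oo] --> g x) ->
  (forall x, 0 <= u x)%R -> measurable_fun setT u ->
  (forall N, \int[mu]_x (F N x * (u x)%:E) <= K) ->
  \int[mu]_x (g x * (u x)%:E) <= K.
Proof.
move=> mF F0 ndF Fg u0 mu_ FK.
have Fu_nd x : nondecreasing_seq (fun N => F N x * (u x)%:E).
  by move=> N M NM; rewrite lee_wpmul2r ?lee_fin//; exact: ndF.
have -> : \int[mu]_x (g x * (u x)%:E) =
    \int[mu]_x (limn (fun N => F N x * (u x)%:E)).
  by apply: eq_integral => x _; apply/esym/cvg_lim => //; exact: cvgeZr.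
have mFu N : measurable_fun setT (fun x => F N x * (u x)%:E).
  by apply: emeasurable_funM => //; exact/measurable_EFinP.
have Fu0 N x : 0 <= F N x * (u x)%:E by rewrite mule_ge0 ?lee_fin.
rewrite monotone_convergence//.
apply: lime_le; last exact: nearW.
apply: ereal_nondecreasing_is_cvgn => N M NM.
by apply: ge0_le_integral => // x _; exact: Fu_nd.
Qed.

Lemma measurable_inv_abs (D : set T) (g : T -> \bar R) : measurable_fun D g ->
  measurable_fun D (fun x => `|g x|^-1).
Proof. by move=> mg; apply: ge0_measurable_inve => //; exact: measurableT_comp. Qed.

Lemma measurable_inv_absM E f u : measurable_fun setT f -> measurable_fun setT u ->
  measurable_fun E (fun x => `|(f x)%:E|^-1 * (u x)%:E).
Proof.
move=> mf mu_; apply: measurable_funTS; apply: emeasurable_funM.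
  by apply: measurable_inv_abs; exact/measurable_EFinP.
exact/measurable_EFinP.
Qed.

Lemma measurable_quotient f u : (forall x, 0 <= u x)%R ->
  measurable_fun setT f -> measurable_fun setT u ->
  measurable_fun setT (fun x => (f x)%:E / (u x)%:E).
Proof.
move=> u0 mf mu_; apply: emeasurable_funM; first exact/measurable_EFinP.
by apply: ge0_measurable_inve => [x|]; [rewrite lee_fin|exact/measurable_EFinP].
Qed.

Lemma abse_inv_ge0 (y : \bar R) : 0 <= `|y|^-1.
Proof. by rewrite inve_ge0. Qed.

(** [f] is finite, so [1 / |f|] vanishes nowhere; a zero integral would force [u = 0] almost
    everywhere on [E]. *)
Lemma integral_inv_absM_gt0 E f u : measurable E -> (forall x, 0 <= u x)%R ->
  measurable_fun setT f -> measurable_fun setT u ->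
  \int[mu]_(x in E) (u x)%:E != 0 ->
  0 < \int[mu]_(x in E) (`|(f x)%:E|^-1 * (u x)%:E).
Proof.
move=> mE u0 mf mu_ S0.
have g0 x : 0 <= `|(f x)%:E|^-1 * (u x)%:E by rewrite mule_ge0 ?abse_inv_ge0 ?lee_fin.
rewrite lt0e integral_ge0// andbT; apply: contra S0 => /eqP I0.
have ae0 : ae_eq mu E (fun x => `|(f x)%:E|^-1 * (u x)%:E) (cst 0).
  apply/(ae_eq_integral_abs mu mE); first exact: measurable_inv_absM.
  by rewrite -[RHS]I0; apply: eq_integral => x _; rewrite gee0_abs.
apply/eqP.
rewrite (ae_eq_integral (cst 0))//; first by rewrite integral0.
  exact/measurable_funTS/measurable_EFinP.
apply: filterS ae0 => x + Ex => /(_ Ex) /eqP; rewrite mule_eq0 => /orP[|/eqP//].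
by rewrite inve_eq0.
Qed.

(** The sides differ only for [y = z = 0], where the left one is [+oo * 0 = 0] and the right one
    [0^-1 = +oo]. *)
Lemma inv_absM_le (y z : R) : (0 <= z)%R -> `|y%:E|^-1 * z%:E <= `|y%:E / z%:E|^-1.
Proof.
rewrite le_eqVlt => /predU1P[<-|z0]; first by rewrite mule0 inve_ge0.
have [->|y0] := eqVneq y 0%R; first by rewrite mul0e !abse0 inve0 leey.
rewrite [in leRHS]inver gt_eqF// -EFinM !abse_EFin !inver normr_eq0 (negbTE y0).
rewrite normr_eq0 mulf_eq0 invr_eq0 (negbTE y0) gt_eqF//= -EFinM lee_fin.
by rewrite normrM normfV (gtr0_norm z0) invfM invrK.
Qed.

(** The numerator 1 excludes [0 / 0], so equality holds; at [z = 0] both sides are 0. *)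
Lemma inv_abs_div1 (z : R) : (0 <= z)%R -> `|1%:E / z%:E|^-1 = z%:E.
Proof.
rewrite le_eqVlt => /predU1P[<-|z0]; first by rewrite inve0 mul1e /= invey.
by rewrite mul1e inver gt_eqF//= inver normr_eq0 invr_eq0 gt_eqF// normfV invrK gtr0_norm.
Qed.

(** [m / I = (m / S) * (S / I)]; since [m] and [S] are positive and finite, this persists for
    [I = 0] and [I = +oo]. *)
Lemma inv_mean_factor (m I : \bar R) (S : R) : 0 < m < +oo -> (0 < S)%R -> 0 <= I ->
  (m^-1 * I)^-1 = (m^-1 * S%:E)^-1 * (S%:E^-1 * I)^-1.
Proof.
case: m => [m||] /andP[m0 moo] S0 I0 //; rewrite lte_fin in m0.
rewrite -inveM.
  rewrite -muleA; congr (_ * _)^-1; rewrite muleA inver (gt_eqF S0) -EFinM.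
  by rewrite divff ?mul1e// gt_eqF.
have SI0 : 0 <= S%:E^-1 * I by rewrite mule_ge0// inve_ge0 lee_fin ltW.
have mS0 : (0 < m^-1 * S)%R by rewrite mulr_gt0 ?invr_gt0.
rewrite inver gt_eqF// -EFinM inveM_defE SI0 /= eqe (gt_eqF mS0) lte_fin mS0.
by rewrite lee_fin (ltW mS0) ltry !implybT.
Qed.

End weighted_integrals.

(** * Harmonic averages *)

Section harmonic_averages.
Variables (R : realType) (n : nat) (B : set (set 'rV[R]_n)).
Hypothesis basisB : open_basis B.
Local Notation mu := (lebesgue R n).
Implicit Types (s u f : 'rV[R]_n -> R) (g : 'rV[R]_n -> \bar R) (E F : set 'rV[R]_n).

Definition haverage g E : \bar R := ((mu E)^-1 * \int[mu]_(y in E) `|g y|^-1)^-1.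

Definition weighted_haverage s f E : \bar R :=
  ((wmeas s E)^-1 * \int[mu]_(y in E) (`|(f y)%:E|^-1 * (s y)%:E))^-1.

Lemma harmonic_maximalE g : harmonic_maximal B g = basis_sup B (haverage g).
Proof. by []. Qed.

Lemma weighted_harmonic_maximalE s f :
  weighted_harmonic_maximal B s (EFin \o f) =
  basis_sup [set E | B E /\ wmeas s E != 0] (weighted_haverage s f).
Proof.
apply/funext => x; rewrite /weighted_harmonic_maximal /basis_sup.
congr (ereal_sup (_ `|` _)); apply/seteqP.
split=> [_ [E [BE Ex sE] <-]|_ [E [[BE sE] Ex] <-]].
- by exists E.
- by exists E.
Qed.

Lemma measurable_basis E : B E -> measurable (E : set (lebesgue_space R n)).
Proof. by move=> /basisB[oE _]; exact: open_lebesgue_measurable. Qed.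

Lemma wmeas_ge0 s E : (forall x, 0 <= s x)%R -> 0 <= wmeas s E.
Proof. by move=> s0; apply: integral_ge0 => x _; rewrite lee_fin. Qed.

Lemma wmeas_cube_lty s E r : weight s ->
  measurable (E : set (lebesgue_space R n)) -> E `<=` @cube R n r -> wmeas s E < +oo.
Proof.
move=> [s0 ms slty] mE Er; apply: le_lt_trans (slty _ (@compact_cube R n r)).
apply: ge0_subset_integral; last exact: Er.
- exact: mE.
- by apply: sub_caratheodory; apply: sub_sigma_algebra; exact: measurable_cube.
- exact/measurable_funTS/measurable_EFinP.
- by move=> x _; rewrite lee_fin.
Qed.

Lemma finite_union_sub_cube F : finite_union B F -> exists r, F `<=` @cube R n r.
Proof.
move=> [G [GB /finite_seqP[l Gl] ->]].
suff [r lr] : exists r, forall E, E \in l -> E `<=` @cube R n r.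
  by exists r; apply: bigcup_sub => E; rewrite Gl => /lr.
have {GB Gl} : forall E, E \in l -> bounded_set E.
  by move=> E El; apply: (basisB _).2; apply: GB; rewrite Gl.
elim: l => [|E l IH] bl; first by exists 0%R.
have [r1 lr1] : exists r, forall E, E \in l -> E `<=` @cube R n r.
  by apply: IH => E' E'l; apply: bl; rewrite in_cons E'l orbT.
have [r2 Er2] := bounded_sub_cube (bl E (mem_head _ _)).
exists (Num.max r1 r2) => E' /[!in_cons] E'l x E'x i.
have [lei|lei] : x ord0 i \in `[(- r1)%R, r1] \/ x ord0 i \in `[(- r2)%R, r2].
- by case/predU1P: E'l E'x => [->|/lr1 E'r1] E'x; [right; exact: Er2|left; exact: E'r1].
- by move: lei; rewrite !in_itv/= -!ler_norml le_max => ->.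
- by move: lei; rewrite !in_itv/= -!ler_norml le_max => ->; rewrite orbT.
Qed.

Lemma measurable_finite_union F : finite_union B F ->
  measurable (F : set (lebesgue_space R n)).
Proof.
move=> [G [GB _ ->]]; apply: open_lebesgue_measurable.
by apply: bigcup_open => E /GB /basisB[].
Qed.

Lemma haverage_ge0 g E : 0 <= haverage g E.
Proof.
by rewrite inve_ge0 mule_ge0 ?inve_ge0// integral_ge0// => y _; exact: abse_inv_ge0.
Qed.

Lemma weighted_haverage_ge0 s f E : (forall x, 0 <= s x)%R ->
  0 <= weighted_haverage s f E.
Proof.
move=> s0; rewrite inve_ge0 mule_ge0 ?inve_ge0 ?wmeas_ge0// integral_ge0// => y _.
by rewrite mule_ge0 ?abse_inv_ge0 ?lee_fin.
Qed.

(** On [E] the function is [1 / s], whose inverse is [s] even where [s = 0]; the value is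
    [|E| / s(E)], read as [+oo] when [s(E) = 0]. *)
Lemma haverage_indic s F E : (forall x, 0 <= s x)%R -> E `<=` F ->
  haverage (divw s \1_F) E = ((mu E)^-1 * wmeas s E)^-1.
Proof.
move=> s0 EF; congr (_ * _)^-1; apply: eq_integral => x /set_mem Ex.
by rewrite /divw indicE mem_set ?inv_abs_div1//; exact: EF.
Qed.

Lemma measurable_harmonic_maximal g :
  measurable_fun [set: lebesgue_space R n] (harmonic_maximal B g).
Proof.
rewrite harmonic_maximalE; apply: measurable_basis_sup; last exact: haverage_ge0.
by move=> E /basisB[].
Qed.

Lemma measurable_weighted_harmonic_maximal s f : (forall x, 0 <= s x)%R ->
  measurable_fun [set: lebesgue_space R n]
    (weighted_harmonic_maximal B s (EFin \o f)).
Proof.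
move=> s0; rewrite weighted_harmonic_maximalE; apply: measurable_basis_sup.
  by move=> E [/basisB[]].
by move=> E; exact: weighted_haverage_ge0.
Qed.

Lemma mu_basis_fin E s : weight s -> B E -> wmeas s E != 0 -> 0 < mu E < +oo.
Proof.
move=> [s0 ms _] BE sE; have [oE bE] := basisB BE.
rewrite bounded_lebesgue_fin// andbT lt0e measure_ge0 andbT.
apply: contra sE => /eqP muE0; apply/eqP; apply: null_set_integral; last exact: muE0.
  exact: measurable_basis.
exact/measurable_funTS/measurable_EFinP.
Qed.

Lemma wmeas_basis_fin E s : weight s -> B E -> wmeas s E \is a fin_num.
Proof.
move=> ws BE; rewrite ge0_fin_numE; last by case: ws => s0 _ _; exact: wmeas_ge0.
have [_ /bounded_sub_cube[r Er]] := basisB BE.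
exact: wmeas_cube_lty ws (measurable_basis BE) Er.
Qed.

(** By [inv_mean_factor] the right side is [|E|] over the integral of [s / |f|]; [inv_absM_le]
    bounds that integrand by [1 / |f / s|], and inversion reverses the order. *)
Lemma haverage_le s f E : weight s -> lebesgue_measurable f -> B E ->
  wmeas s E != 0 ->
  haverage (divw s f) E <=
    ((mu E)^-1 * wmeas s E)^-1 * weighted_haverage s f E.
Proof.
move=> ws mf BE sE; have muE := mu_basis_fin ws BE sE.
have Sfin := wmeas_basis_fin ws BE; case: ws => s0 ms _.
have S0 : (0 < fine (wmeas s E))%R.
  by rewrite fine_gt0// lt0e sE wmeas_ge0//= -ge0_fin_numE// wmeas_ge0.
have If0 y : 0 <= `|(f y)%:E|^-1 * (s y)%:E.
  by rewrite mule_ge0 ?abse_inv_ge0 ?lee_fin.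
rewrite /weighted_haverage -(fineK Sfin) -inv_mean_factor//; last first.
  exact: integral_ge0.
rewrite /haverage lee_pV2 ?inE; last 2 first.
- rewrite mule_ge0 ?inve_ge0// integral_ge0// => y _; exact: abse_inv_ge0.
- by rewrite mule_ge0 ?inve_ge0// integral_ge0.
rewrite lee_wpmul2l ?inve_ge0//; apply: ge0_le_integral.
- exact: measurable_basis.
- by move=> y _; exact: If0.
- exact: measurable_inv_absM.
- apply: measurable_inv_abs; apply: measurable_funTS.
  exact: measurable_quotient.
- by move=> y _; exact: inv_absM_le.
Qed.

(** An infinite value would need [s(E) = +oo] or a zero integral of [s / |f|]. Finiteness lets the
    layer cake run on real levels. *)
Lemma weighted_haverage_fin s f E : weight s -> lebesgue_measurable f -> B E ->
  wmeas s E != 0 -> weighted_haverage s f E \is a fin_num.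
Proof.
move=> ws mf BE sE; have Sfin := wmeas_basis_fin ws BE; case: ws => s0 ms _.
rewrite ge0_fin_numE ?weighted_haverage_ge0// ltey inve_eqy mule_eq0 negb_or.
rewrite inve_eq0; apply/andP; split; first by apply: contraTneq Sfin => ->.
rewrite gt_eqF//.
apply: integral_inv_absM_gt0; [|exact: s0|exact: mf|exact: ms|exact: sE].
exact: measurable_basis.
Qed.

End harmonic_averages.

(** * Testing implies the strong type inequality *)

Section testing_implies_strong.
Variables (R : realType) (n : nat) (B : set (set 'rV[R]_n)).
Variables (u s : 'rV[R]_n -> R) (p C : R).
Hypotheses (basisB : open_basis B) (wu : weight u) (ws : weight s).
Hypotheses (p0 : (0 < p)%R) (C0 : (0 <= C)%R).
Local Notation mu := (lebesgue R n).
Hypothesis testing : forall F : set 'rV[R]_n, finite_union B F ->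
  \int[mu]_(x in F) (harmonic_maximal B (divw s (\1_F)) x `^ p * (u x)%:E)
    <= C%:E * wmeas s F.

Let u0 : forall x, (0 <= u x)%R. Proof. by case: wu. Qed.
Let s0 : forall x, (0 <= s x)%R. Proof. by case: ws. Qed.
Let mu_ : measurable_fun [set: lebesgue_space R n] (u : lebesgue_space R n -> R).
Proof. by case: wu. Qed.
Let ms : measurable_fun [set: lebesgue_space R n] (s : lebesgue_space R n -> R).
Proof. by case: ws. Qed.

Let mMu g : measurable_fun [set: lebesgue_space R n]
  (fun x : lebesgue_space R n => harmonic_maximal B g x `^ p * (u x)%:E).
Proof.
apply: emeasurable_funM; last exact/measurable_EFinP.
apply: (measurableT_comp (measurable_poweR p)).
exact: measurable_harmonic_maximal.
Qed.

(* Testing on [E] itself, where the maximal function is infinite. *)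
Lemma testing_null E : B E -> wmeas s E = 0 ->
  {ae mu, forall x, E x -> u x = 0%R}.
Proof.
move=> BE sE; have mE := measurable_basis basisB BE.
apply: (integral0_ae_eq0 mE u0 mu_).
apply/eqP; rewrite eq_le; apply/andP; split; last first.
  by apply: integral_ge0 => x _; rewrite lee_fin.
have fE : finite_union B E.
  by exists [set E]; split; [move=> _ ->|exact: finite_set1|rewrite bigcup_set1].
have := testing fE; rewrite sE mule0; apply: le_trans.
apply: ge0_le_integral; first exact: mE.
- by move=> x _; rewrite lee_fin.
- exact/measurable_funTS/measurable_EFinP.
- exact: measurable_funTS.
move=> x Ex; suff -> : harmonic_maximal B (divw s \1_E) x = +oo.
  rewrite poweRyr ?gt_eqF//.
  have [->|ux] := eqVneq (u x) 0%R; first by rewrite mule0.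
  by rewrite gt0_mulye ?leey// lte_fin lt0r ux u0.
apply/eqP; rewrite -leye_eq harmonic_maximalE.
apply: le_trans (basis_sup_ub (haverage (divw s \1_E)) BE Ex).
by rewrite haverage_indic// sE mule0 inve0.
Qed.

(** [(|G i| / s(G i))^p] as a real number; [fine] sends an infinite value to 0, but no index in the
    lists below has one. *)
Let a (G : nat -> set 'rV[R]_n) i : R := fine (((mu (G i))^-1 * wmeas s (G i))^-1 `^ p).

(** Testing on the union [F] of the listed sets: each [G i] lies in [F], so it competes in the
    maximal function of [1_F / s] with the value [|G i| / s(G i)], while the maximum of the
    indicators is [1_F]. *)
Lemma testing_max_indic (G : nat -> set 'rV[R]_n) (l : seq nat) :
  (forall i, measurable (G i : set (lebesgue_space R n))) ->
  (forall i, i \in l -> B (G i) /\ wmeas s (G i) != 0) ->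
  \int[mu]_x ((max_indic G l (a G) x)%:E * (u x)%:E) <=
  C%:E * \int[mu]_x ((max_indic G l (cst 1%R) x)%:E * (s x)%:E).
Proof.
move=> mG lB.
pose F := \bigcup_(i in [set` l]) G i.
have fF : finite_union B F.
  exists [set G i | i in [set` l]]; split.
  - by move=> _ [i /= /lB[BG _] <-].
  - exact/finite_image/finite_seq.
  - by rewrite bigcup_image.
have GF i : i \in l -> G i `<=` F by move=> il x Gx; exists i.
have mF : measurable (F : set (lebesgue_space R n)).
  by apply: bigcup_measurable => i _; exact: mG.
have -> : \int[mu]_x ((max_indic G l (cst 1%R) x)%:E * (s x)%:E) = wmeas s F.
  rewrite /wmeas [RHS]integral_mkcond; apply: eq_integral => x _.
  rewrite patchE; case: ifPn => [/set_mem[i /= il Gx]|xF].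
    rewrite (_ : max_indic _ _ _ _ = 1%R) ?mul1e//.
    apply/eqP; rewrite eq_le max_indic1_le1/=.
    have := max_indic_ub G (cst 1%R : nat -> R) x il.
    by rewrite mul1r indicE mem_set.
  rewrite (_ : max_indic _ _ _ _ = 0%R) ?mul0e//.
  apply/eqP; rewrite eq_le max_indic_ge0 andbT.
  apply: max_indic_le => // i il; rewrite indicE memNset ?mulr0// => Gx.
  by move/negP: xF; apply; apply/mem_set/(GF i).
apply: le_trans (testing fF).
rewrite [leRHS]integral_mkcond.
have M0 x : 0 <= harmonic_maximal B (divw s \1_F) x `^ p * (u x)%:E.
  by rewrite mule_ge0 ?poweR_ge0 ?lee_fin.
apply: ge0_le_integral; first exact: measurableT.
- by move=> x _; rewrite mule_ge0 ?lee_fin ?max_indic_ge0.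
- apply: emeasurable_funM; apply/measurable_EFinP; last exact: mu_.
  exact: measurable_max_indic.
- by apply/(measurable_restrictT _ mF)/measurable_funTS; exact: mMu.
move=> x _; rewrite patchE; case: ifPn => [xF|xF]; last first.
  rewrite (_ : max_indic _ _ _ _ = 0%R) ?mul0e//.
  apply/eqP; rewrite eq_le max_indic_ge0 andbT.
  apply: max_indic_le => // i il; rewrite indicE memNset ?mulr0// => Gx.
  by move/negP: xF; apply; apply/mem_set/(GF i).
rewrite lee_wpmul2r ?lee_fin//.
(* Where the maximal function is [+oo] the bound is trivial; elsewhere the comparison descends to
   real numbers. *)
have [->|] := eqVneq (harmonic_maximal B (divw s \1_F) x) +oo.
  by rewrite poweRyr ?gt_eqF// leey.
rewrite -ltey -ge0_fin_numE ?harmonic_maximalE ?basis_sup_ge0// => Mfin.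
rewrite -(fineK (fin_num_poweR p Mfin)) lee_fin.
apply: max_indic_le => [|i il]; first by rewrite fine_ge0// poweR_ge0.
rewrite indicE; case: (boolP (x \in G i)) => [/set_mem Gx|_]; last first.
  by rewrite mulr0 fine_ge0// poweR_ge0.
have [BG _] := lB i il.
have aM : ((mu (G i))^-1 * wmeas s (G i))^-1 <=
    basis_sup B (haverage (divw s \1_F)) x.
  apply: le_trans (basis_sup_ub (haverage (divw s \1_F)) BG Gx).
  by rewrite haverage_indic//; exact: GF.
have c0 : 0 <= ((mu (G i))^-1 * wmeas s (G i))^-1.
  by rewrite inve_ge0 mule_ge0 ?inve_ge0 ?wmeas_ge0.
rewrite mulr1; apply: fine_le; last exact: ge0_le_poweR (ltW p0) c0 aM.
  apply: fin_num_poweR; rewrite ge0_fin_numE//.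
  by apply: le_lt_trans aM _; rewrite -ge0_fin_numE ?basis_sup_ge0.
exact: fin_num_poweR.
Qed.

(** The testing constant is kept, and both sides may be infinite; boundedness of the weighted
    operator enters only afterwards. *)
Lemma testing_strong f : lebesgue_measurable f ->
  Lp_pow p u (harmonic_maximal B (divw s f)) <=
  C%:E * Lp_pow p s (weighted_harmonic_maximal B s (EFin \o f)).
Proof.
move=> mf; pose c E := haverage (divw s f) E `^ p.
have c0 E : 0 <= c E by exact: poweR_ge0.
have oB E : B E -> open E by move=> /basisB[].
have [G GB Gc] := basis_sup_lim oB c0.
have oG i : open (G i) by case: (GB i) => [->|/oB//]; exact: open0.
have mG i : measurable (G i : set (lebesgue_space R n)).
  exact: open_lebesgue_measurable.
have -> : Lp_pow p u (harmonic_maximal B (divw s f)) =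
    \int[mu]_x (basis_sup B c x * (u x)%:E).
  apply: eq_integral => x _; rewrite harmonic_maximalE gee0_abs ?basis_sup_ge0//.
  by rewrite poweR_basis_sup// => E; exact: haverage_ge0.
apply: (@integral_lim_le _ (lebesgue_space R n) R mu (partial_sup G c)).
- by move=> N; exact: measurable_partial_sup.
- by move=> N x; exact: partial_sup_ge0.
- by move=> x; exact: partial_sup_nd.
- exact: Gc.
- exact: u0.
- exact: mu_.
move=> N.
pose v i := fine (weighted_haverage s f (G i) `^ p).
(* Indices whose set lies outside [B] or has zero [s]-measure are dropped; the rest are sorted by
   level, since slabs are peeled off from below. *)
pose l := sort (fun i j => v i <= v j)%R
  [seq i <- iota 0 N | `[< B (G i) >] && (wmeas s (G i) != 0)].
have lB i : i \in l -> B (G i) /\ wmeas s (G i) != 0.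
  by rewrite mem_sort mem_filter => /andP[/andP[/asboolP]].
have vE i : i \in l -> weighted_haverage s f (G i) `^ p = (v i)%:E.
  move=> /lB[BG sG]; rewrite fineK// fin_num_poweR//.
  exact: (weighted_haverage_fin basisB ws).
have v0 i : (0 <= v i)%R by rewrite fine_ge0// poweR_ge0.
have a0 i : (0 <= a G i)%R by rewrite fine_ge0// poweR_ge0.
have avE i : i \in l -> c (G i) <= (a G i * v i)%:E.
  move=> il; have [BG sG] := lB i il.
  rewrite EFinM -vE// fineK; last first.
    have /andP[m0 moo] := mu_basis_fin basisB ws BG sG.
    apply: fin_num_poweR; rewrite ge0_fin_numE; last first.
      by rewrite inve_ge0 mule_ge0 ?inve_ge0 ?wmeas_ge0.
    rewrite ltey inve_eqy mule_eq0 negb_or sG andbT inve_eq0.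
    by rewrite lt_eqF.
  rewrite -poweRM; [|by rewrite inve_ge0 mule_ge0 ?inve_ge0 ?wmeas_ge0|].
    apply: ge0_le_poweR; [exact: ltW|exact: haverage_ge0|].
    exact: (haverage_le basisB ws mf BG sG).
  exact: weighted_haverage_ge0.
(* The [- 0] is the base level [c = 0] of [testing_sorted]. *)
apply: (@le_trans _ _ (\int[mu]_x
    ((max_indic G l (fun i => a G i * (v i - 0))%R x)%:E * (u x)%:E))).
  apply: ae_ge0_le_integral; first exact: measurableT.
  - by move=> x _; rewrite mule_ge0 ?partial_sup_ge0 ?lee_fin.
  - apply: emeasurable_funM; last exact/measurable_EFinP.
    exact: measurable_partial_sup.
  - by move=> x _; rewrite mule_ge0 ?lee_fin ?max_indic_ge0.
  - apply: emeasurable_funM; apply/measurable_EFinP; last exact: mu_.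
    exact: measurable_max_indic.
  (* Countably many exceptional null sets, at most one for each [i], have a null union. *)
  have : {ae mu, forall x, forall i, B (G i) -> wmeas s (G i) = 0 -> G i x -> u x = 0%R}.
    apply: ae_foralln => i.
    have [[BG sG]|nBs] := pselect (B (G i) /\ wmeas s (G i) = 0).
      by apply: ae_imply (testing_null BG sG) => x ux _ _; exact: ux.
    by apply: aeW => x BG sG; case: nBs.
  apply: ae_imply => x ux0 _.
  (* Where [u x] is nonzero, every [G i] with [i < N] through [x] has nonzero [s]-measure, hence is
     listed. *)
  have [->|ux] := eqVneq (u x) 0%R; first by rewrite !mule0.
  rewrite lee_wpmul2r ?lee_fin//; apply: partial_sup_le.
    by rewrite lee_fin max_indic_ge0.
  move=> i iN Gx; have BG : B (G i) by case: (GB i) => // Gi0; move: Gx; rewrite Gi0.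
  have sG : wmeas s (G i) != 0.
    by apply: contraNneq ux => sG; apply/eqP; exact: (ux0 i).
  have il : i \in l by rewrite mem_sort mem_filter mem_iota sG asboolT//= iN.
  apply: (le_trans (avE i il)); rewrite lee_fin.
  have := max_indic_ub G (fun i => a G i * (v i - 0))%R x il.
  by rewrite indicE mem_set// mulr1 subr0.
apply: (@le_trans _ _ (C%:E * \int[mu]_x
    ((max_indic G l (fun i => v i - 0)%R x)%:E * (s x)%:E))).
  apply: testing_sorted; [exact: mG|exact: u0|exact: mu_|exact: s0|exact: ms|exact: C0|
    exact: a0| | |by move=> i _; exact: v0].
  - by move=> l' l'l; apply: testing_max_indic => // i /l'l; exact: lB.
  - by apply: sort_sorted => i j; exact: le_total.
rewrite lee_wpmul2l ?lee_fin//; apply: ge0_le_integral; first exact: measurableT.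
- by move=> x _; rewrite mule_ge0 ?lee_fin ?max_indic_ge0.
- apply: emeasurable_funM; apply/measurable_EFinP; last exact: ms.
  exact: measurable_max_indic.
- apply: emeasurable_funM; last exact/measurable_EFinP.
  apply: (measurableT_comp (measurable_poweR p)); apply: measurableT_comp.
    exact: abse_measurable.
  exact: measurable_weighted_harmonic_maximal.
(* Every listed [G i] is admissible in the weighted maximal function, whose [p]-th power thus
   dominates each level. *)
move=> x _; rewrite lee_wpmul2r ?lee_fin//.
rewrite weighted_harmonic_maximalE gee0_abs ?basis_sup_ge0//.
rewrite poweR_basis_sup//; last by move=> E; exact: weighted_haverage_ge0.
set M := basis_sup _ _ _.
have M0 : 0 <= M by exact: basis_sup_ge0.
have [->|] := eqVneq M +oo; first by rewrite leey.
rewrite -ltey -ge0_fin_numE// => Mfin; rewrite -(fineK Mfin) lee_fin.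
apply: max_indic_le => [|i il]; first exact: fine_ge0.
rewrite indicE; case: (boolP (x \in G i)) => [/set_mem Gx|_]; last first.
  by rewrite mulr0 fine_ge0.
rewrite mulr1 subr0 -lee_fin -vE// fineK//.
exact: (basis_sup_ub (fun E => weighted_haverage s f E `^ p) (lB i il) Gx).
Qed.

End testing_implies_strong.

(** * The equivalence *)

(** Off [F] this rests on [0 ^ p = 0], which is where [p > 0] enters. *)
Lemma Lp_pow_indic (R : realType) (n : nat) (s : 'rV[R]_n -> R) (p : R)
    (F : set 'rV[R]_n) :
  (0 < p)%R -> Lp_pow p s (EFin \o \1_F) = wmeas s F.
Proof.
move=> p0; rewrite /wmeas [RHS]integral_mkcond; apply: eq_integral => x _.
rewrite [X in `|X|]/= indicE patchE; case: ifP => _; first by rewrite abse1 poweR1r mul1e.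
by rewrite abse0 poweR0r ?mul0e// gt_eqF.
Qed.

(** Take [f = 1_F], which is in [L^p(s)] because [F] is bounded and so [s(F)] is finite; restricting
    the left integral to [F] only decreases it. *)
Lemma strong_testing (R : realType) (n : nat) (B : set (set 'rV[R]_n))
    (u s : 'rV[R]_n -> R) (p C1 : R) :
  open_basis B -> weight u -> weight s -> (0 < p)%R ->
  (forall f : 'rV[R]_n -> R, in_Lp p s f ->
     Lp_pow p u (harmonic_maximal B (divw s f)) <= C1%:E * Lp_pow p s (EFin \o f)) ->
  forall F : set 'rV[R]_n, finite_union B F ->
    \int[lebesgue R n]_(x in F)
      (harmonic_maximal B (divw s (\1_F)) x `^ p * (u x)%:E) <= C1%:E * wmeas s F.
Proof.
move=> basisB [u0 mu_ _] ws p0 strong F fF.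
have mF := measurable_finite_union basisB fF.
have [r Fr] := finite_union_sub_cube basisB fF.
rewrite -(Lp_pow_indic s F p0); apply: le_trans (strong _ _); last first.
  split; last by rewrite Lp_pow_indic//; exact: wmeas_cube_lty Fr.
  exact: measurable_indic.
apply: (@le_trans _ _ (\int[lebesgue R n]_x
    (harmonic_maximal B (divw s (\1_F)) x `^ p * (u x)%:E))).
  apply: ge0_subset_integral; [exact: mF|exact: measurableT| | |exact: subsetT].
  - apply: emeasurable_funM; last exact/measurable_EFinP.
    apply: (measurableT_comp (measurable_poweR p)).
    exact: measurable_harmonic_maximal.
  - by move=> x _; rewrite mule_ge0 ?poweR_ge0 ?lee_fin.
rewrite le_eqVlt; apply/orP; left; apply/eqP; apply: eq_integral => x _.
by rewrite gee0_abs// harmonic_maximalE basis_sup_ge0.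
Qed.

Unset Implicit Arguments.

Theorem theorem2p3 (R : realType) (n : nat) (B : set (set 'rV[R]_n))
    (u s : 'rV[R]_n -> R) (p : R) :
  open_basis B -> weight u -> weight s -> (0 < p)%R ->
  (exists C0 : R, forall f : 'rV[R]_n -> R, in_Lp p s f ->
     Lp_pow p s (weighted_harmonic_maximal B s (EFin \o f))
       <= C0%:E * Lp_pow p s (EFin \o f)) ->
  (exists C1 : R, forall f : 'rV[R]_n -> R, in_Lp p s f ->
     Lp_pow p u (harmonic_maximal B (divw s f))
       <= C1%:E * Lp_pow p s (EFin \o f))
  <->
  (exists C : R, forall F : set 'rV[R]_n, finite_union B F ->
     \int[lebesgue R n]_(x in F)
         (harmonic_maximal B (divw s (\1_F)) x `^ p * (u x)%:E)
       <= C%:E * wmeas s F).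
Proof.
move=> basisB wu ws p0 [C0 MC0]; split=> [[C1 strong]|[C testing]].
  by exists C1; exact: strong_testing.
have s0 : forall x, (0 <= s x)%R by case: ws.
(* A negative [C] is replaced by 0, so that inequalities can be multiplied by the constant. *)
pose C' := Num.max C 0%R; have C'0 : (0 <= C')%R by rewrite le_max lexx orbT.
have {}testing F : finite_union B F ->
    \int[lebesgue R n]_(x in F)
      (harmonic_maximal B (divw s (\1_F)) x `^ p * (u x)%:E) <= C'%:E * wmeas s F.
  move=> /testing /le_trans; apply; rewrite lee_wpmul2r ?wmeas_ge0//.
  by rewrite lee_fin le_max lexx.
exists (C' * C0)%R => f fLp; have [mf _] := fLp.
apply: le_trans (testing_strong basisB wu ws p0 C'0 testing mf) _.
by rewrite EFinM -muleA lee_wpmul2l ?lee_fin//; exact: MC0.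
Qed.
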